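(* Let $F,\ell_1,\dots,\ell_m:\mathbb{R}^n\to\mathbb{R}$ be continuously differentiable with $F^*:=\inf_{\theta}F(\theta)>-\infty$, $\ell_i^*:=\inf_\theta\ell_i(\theta)>-\infty$ for all $i$, and $\sup_\theta\|\nabla F(\theta)\|\le c$. Let $e>0$, let $\alpha_t\ge0$ for all $t\in\mathbb{R}_+$, and let $\{\theta_t:t\in\mathbb{R}_+\}$ be a solution of the Pareto navigation flow $d\theta_t=-v_t\,dt$ (see context). Assume $\theta_0\notin\mathcal{P}_e$, and let $t_e$ be the first time at which $\theta_{t_e}\in\mathcal{P}_e$ ($t_e=+\infty$ if there is no such time). (i) For (almost) every time $t<t_e$ and every $i\in\{1,\dots,m\}$, $$\frac{d}{dt}\ell_i(\theta_t)\le-\alpha_t\,g(\theta_t),$$ and for every $t<t_e$ with $\int_0^t\alpha_s\,ds>0$, $$\min_{s\in[0,t]}g(\theta_s)\le\frac{\min_{i\in\{1,\dots,m\}}(\ell_i(\theta_0)-\ell_i^* )}{\int_0^t\alpha_s\,ds}.$$ Therefore the flow yields Pareto improvement when $\theta_t\notin\mathcal{P}_e$ and $\alpha_tg(\theta_t)>0$: for almost every such $t$, $\frac{d}{dt}\ell_i(\theta_t)<0$ for all $i$. (ii) Further, if $\int_0^\infty\alpha_s\,ds=+\infty$, then for any $\epsilon>e$ there exists a finite time $t_\epsilon\in\mathbb{R}_+$ such that $\theta_{t_\epsilon}\in\mathcal{P}_\epsilon$ and $\theta_t\in\overline{\mathcal{P}}_\epsilon$ for all $t\ge t_\epsilon$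.
   Context: $\|\cdot\|$ is the Euclidean norm, $\mathbb{R}_+=[0,\infty)$, $\mathcal{C}^m=\{\omega\in\mathbb{R}_+^m:\sum_i\omega_i=1\}$, and $\vec\ell=(\ell_1,\dots,\ell_m)$. Define $$g(\theta)=\min_{\omega\in\mathcal{C}^m}\Big\|\sum_{i=1}^m\omega_i\nabla\ell_i(\theta)\Big\|^2,\qquad \mathcal{P}_\epsilon=\{\theta\in\mathbb{R}^n:g(\theta)\le\epsilon\}.$$ Write $\vec\ell(\theta')\preceq\vec\ell(\theta)$ if $\ell_i(\theta')\le\ell_i(\theta)$ for all $i$. The Pareto closure of a point is $\overline{\{\theta\}}=\{\theta'\in\mathbb{R}^n:\vec\ell(\theta')\preceq\vec\ell(\theta)\}$, and $\overline{\mathcal{P}}_\epsilon=\bigcup_{\theta\in\mathcal{P}_\epsilon}\overline{\{\theta\}}$. Pareto navigation flow: $t\mapsto\alpha_t$ is measurable. The velocity $v_t$ at $\theta_t$ is $$v_t=\arg\min_{v\in\mathbb{R}^n}\tfrac12\|\nabla F(\theta_t)-v\|^2\ \text{ s.t. }\ \nabla\ell_i(\theta_t)^\top v\ge\phi_t\ \forall i,\qquad \phi_t=\begin{cases}-\infty& g(\theta_t)\le e,\\ \alpha_tg(\theta_t)& g(\theta_t)>e,\end{cases}$$ so $v_t=\nabla F(\theta_t)$ when $g(\theta_t)\le e$. Since $v_t$ is discontinuous across the boundary of $\mathcal{P}_e$, solutions of $d\theta_t=-v_t\,dt$ are taken in the Filippov (differential inclusion) sense: $t\mapsto\theta_t$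 is locally absolutely continuous on $\mathbb{R}_+$ and for almost every $t$, $\frac{d\theta_t}{dt}=-v_t$ if $\theta_t\notin\mathcal{P}_e$; $\frac{d\theta_t}{dt}=-\nabla F(\theta_t)$ if $\theta_t$ is in the interior of $\mathcal{P}_e$; and if $\theta_t$ is on the boundary of $\mathcal{P}_e$, $\frac{d\theta_t}{dt}=-(\beta w_t+(1-\beta)\nabla F(\theta_t))$ for some $\beta\in[0,1]$ (possibly depending on $t$), where $w_t$ is the minimizer of the same quadratic program with $\phi_t$ replaced by $\alpha_tg(\theta_t)$. *)

(* Defs.v *)
From HB Require Import structures.
From mathcomp Require Import all_boot all_order all_algebra.
From mathcomp Require Import all_classical all_reals all_analysis.

Set Implicit Arguments.
Unset Strict Implicit.
Unset Printing Implicit Defensive.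
Import Order.TTheory GRing.Theory Num.Theory.
Import numFieldNormedType.Exports.
Local Open Scope classical_set_scope.
Local Open Scope ring_scope.

Definition minima (R : realType) (A : set R) : set R := A `&` lbound A.

(* The minimum of [A]; the default value [0] is only taken when [A] has no
   minimum. *)
Definition minimum (R : realType) (A : set R) : R := xget 0 (minima A).

Definition dotp (R : realType) (n : nat) (u v : 'rV[R]_n) : R :=
  \sum_(j < n) u 0 j * v 0 j.

(* The library norm [`|u|] on ['rV[R]_n] is the sup norm, so the Euclidean norm
   has to be introduced. The two induce the same topology. *)
Definition enorm (R : realType) (n : nat) (u : 'rV[R]_n) : R :=
  Num.sqrt (dotp u u).

Definition grad (R : realType) (n : nat) (f : 'rV[R]_n -> R) (x : 'rV[R]_n) :
    'rV[R]_n :=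
  \row_(j < n) 'D_(delta_mx 0 j) f x.

Definition C1 (R : realType) (n : nat) (f : 'rV[R]_n -> R) : Prop :=
  (forall x, differentiable f x) /\ continuous (grad f).

Definition simplex (R : realType) (m : nat) : set 'rV[R]_m :=
  [set w | (forall i, 0 <= w 0 i) /\ \sum_(i < m) w 0 i = 1].

Definition gfun (R : realType) (n m : nat) (l : 'I_m -> 'rV[R]_n -> R)
    (x : 'rV[R]_n) : R :=
  minimum [set enorm (\sum_(i < m) w 0 i *: grad (l i) x) ^+ 2
          | w in @simplex R m].

Definition pareto (R : realType) (n m : nat) (l : 'I_m -> 'rV[R]_n -> R)
    (eps : R) : set 'rV[R]_n :=
  [set x | gfun l x <= eps].

Definition pareto_le (R : realType) (n m : nat) (l : 'I_m -> 'rV[R]_n -> R)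
    (y x : 'rV[R]_n) : Prop :=
  forall i, l i y <= l i x.

Definition pareto_closure_pt (R : realType) (n m : nat)
    (l : 'I_m -> 'rV[R]_n -> R) (x : 'rV[R]_n) : set 'rV[R]_n :=
  [set y | pareto_le l y x].

Definition pareto_closure (R : realType) (n m : nat)
    (l : 'I_m -> 'rV[R]_n -> R) (eps : R) : set 'rV[R]_n :=
  \bigcup_(x in pareto l eps) pareto_closure_pt l x.

Definition qp_feasible (R : realType) (n m : nat) (l : 'I_m -> 'rV[R]_n -> R)
    (x : 'rV[R]_n) (phi : \bar R) : set 'rV[R]_n :=
  [set v | forall i, (phi <= (dotp (grad (l i) x) v)%:E)%E].

Definition qp_argmin (R : realType) (n m : nat) (F : 'rV[R]_n -> R)
    (l : 'I_m -> 'rV[R]_n -> R) (x : 'rV[R]_n) (phi : \bar R) :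
    set 'rV[R]_n :=
  [set v | qp_feasible l x phi v /\
     forall u, qp_feasible l x phi u ->
       2^-1 * enorm (grad F x - v) ^+ 2 <= 2^-1 * enorm (grad F x - u) ^+ 2].

Definition control (R : realType) (n m : nat) (l : 'I_m -> 'rV[R]_n -> R)
    (e a : R) (x : 'rV[R]_n) : \bar R :=
  if gfun l x <= e then -oo%E else (a * gfun l x)%:E.

(* [R] equipped with the sigma-algebra of Lebesgue (rather than Borel)
   measurable sets, on which [completed_lebesgue_measure] is defined. *)
Notation lebesgueTypeR R := (caratheodory_type (wlength (@idfun R))^*%mu).

(* For ['rV[R]_n] the library norm used here is the sup norm; absolute
   continuity is insensitive to replacing it with the equivalent Euclidean
   norm. *)
Definition abs_continuous (R : realType) (V : normedModType R) (a b : R)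
    (f : R -> V) : Prop :=
  forall eps : R, 0 < eps -> exists2 delta : R, 0 < delta &
    forall (k : nat) (I : 'I_k -> R * R),
      (forall i, [/\ a <= (I i).1, (I i).1 <= (I i).2 & (I i).2 <= b]) ->
      trivIset setT (fun i => `](I i).1, (I i).2[%classic) ->
      \sum_(i < k) ((I i).2 - (I i).1) < delta ->
      \sum_(i < k) `|f (I i).2 - f (I i).1| < eps.

(* Trajectories are functions on all of [R], but only their values on
   [0, +oo) matter: the derivative is constrained at almost every [t >= 0],
   so the two-sided derivative at [0] plays no role. *)
Definition pareto_flow (R : realType) (n m : nat) (F : 'rV[R]_n -> R)
    (l : 'I_m -> 'rV[R]_n -> R) (e : R) (alpha : R -> R)
    (theta : R -> 'rV[R]_n) : Prop :=
  (forall T : R, 0 <= T -> abs_continuous 0 T theta) /\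
  {ae lebesgue_measure, forall t : R, 0 <= t ->
    [/\ ~ pareto l e (theta t) ->
          exists2 v, qp_argmin F l (theta t)
                       (control l e (alpha t) (theta t)) v &
            is_derive t (1 : R) theta (- v),
        interior (pareto l e) (theta t) ->
          is_derive t (1 : R) theta (- grad F (theta t)) &
        (closure (pareto l e) `\` interior (pareto l e)) (theta t) ->
          exists beta : R, exists2 w,
            0 <= beta <= 1 /\
            qp_argmin F l (theta t) (alpha t * gfun l (theta t))%:E w &
            is_derive t (1 : R) theta
              (- (beta *: w + (1 - beta) *: grad F (theta t)))]}.

(* [+oo] when [A] is never reached. For [A] closed and [theta] continuous the
   infimum is attained whenever it is finite. *)
Definition first_time (R : realType) (T : Type) (A : set T) (theta : R -> T) :
    \bar R :=
  ereal_inf [set t%:E | t in [set t : R | 0 <= t /\ A (theta t)]].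

(* Main.v *)
(** Outside [P_e] the velocity satisfies every constraint
    [grad l_i . v >= alpha_t g], so the chain rule gives
    [(l_i o theta)' <= - alpha_t g] almost everywhere. Each [l_i o theta] is
    absolutely continuous, so integrating the inequality over a time interval
    on which [d <= g] gives [d * int alpha <= l_i (start) - l_i (end)], and
    [l_i (end) >= inf l_i]; this is the rate in (i). If [int alpha] diverges,
    [g] cannot stay above [eps > e] for ever, so the trajectory meets [P_eps];
    after the last visit to [P_eps] before a time [t] it stays outside [P_e],
    where all the losses decrease, hence [theta_t] is dominated by that last
    visit.

    The integration step rests on two facts. An absolutely continuous function
    whose derivative is nonpositive almost everywhere is nonincreasing: cover
    the exceptional null set by an open set of small measure and go from [a]
    to [b] by steps which either obey the derivative bound or stay in that
    open set. And the integral of [h >= 0] is a supremum of integrals of simple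
    functions, which may be replaced by bounded Borel functions [g <= h]; then
    [f + int g] has nonpositive derivative by Lebesgue differentiation. *)

Require Import Defs.
From HB Require Import structures.
From mathcomp Require Import all_boot all_order all_algebra finmap.
From mathcomp Require Import all_classical all_reals all_analysis.
From mathcomp Require Import measurable_realfun.
From mathcomp Require Import lra.
Import Order.TTheory GRing.Theory Num.Theory.
Import numFieldNormedType.Exports.
Local Open Scope classical_set_scope.
Local Open Scope ring_scope.

Set Implicit Arguments.
Unset Strict Implicit.
Unset Printing Implicit Defensive.

(** * Absolutely continuous functions *)

(** Real induction. Let [c] be the supremum of the points of [[a, b]] satisfying [P]. A good point
    just below [c] is carried by one step across [c], to a point beyond [c] unless [c = b]. Since
    steps straddle [c], [P] need not be known at [c] beforehand. *)
Lemma itv_step_ind (R : realType) (a b : R) (P : R -> Prop) :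
  a <= b -> P a ->
  (forall x, a <= x <= b -> exists2 d, 0 < d & forall u v,
     a <= u <= x -> x <= v <= b -> x - d < u -> v < x + d -> P u -> P v) ->
  P b.
Proof.
move=> ab Pa stepP.
pose S := [set x | a <= x <= b /\ P x].
have Sa : S a by split=> //; rewrite lexx.
have ubS : ubound S b by move=> x [/andP[]].
have supS : has_sup S by split; [exists a | exists b].
have ac : a <= sup S by apply: (ub_le_sup supS.2).
have cb : sup S <= b by apply: (ge_sup supS.1 ubS).
have [|d d0 stepc] := stepP (sup S); first by rewrite ac cb.
have [u [/andP[au ub] Pu] cu] := sup_adherent d0 supS.
have uc : u <= sup S by apply: (ub_le_sup supS.2); split=> //; rewrite au.
pose v := Num.min (sup S + d / 2) b.
have cv : sup S <= v by rewrite le_min cb andbT; lra.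
have Pv : P v.
  apply: (stepc u) => //; first by rewrite au.
    by rewrite cv ge_min lexx orbT.
  by rewrite gt_min; apply/orP; left; lra.
have vc : v <= sup S.
  apply: (ub_le_sup supS.2).
  by split=> //; rewrite (le_trans ac cv) ge_min lexx orbT.
suff -> : b = v by [].
move: vc; rewrite /v; case: (leP (sup S + d / 2) b) => // _ h; lra.
Qed.

(** Difference quotients based at [x] are at most [e] on both sides, and the increments over
    [[u, x]] and [[x, v]] add up. Differentiability at the single point [x] controls only pairs
    straddling it. *)
Lemma derive1_le0_straddle (R : realType) (f : R -> R) (x e : R) :
  derivable f x 1 -> derive1 f x <= 0 -> 0 < e ->
  exists2 d, 0 < d & forall u v, x - d < u -> u <= x -> x <= v -> v < x + d ->
    f v - f u <= e * (v - u).
Proof.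
move=> dfx fx0 e0.
have : (fun h => h^-1 *: (f (h + x) - f x)) @ 0^' --> derive1 f x.
  rewrite derive1E; have := dfx; rewrite /derivable /derive.
  by under eq_fun do rewrite -[_%:A]/(_ * 1) mulr1.
move=> /cvgrPdist_lt /(_ _ e0) [d /= d0 hd].
have quot h : h != 0 -> `|h| < d -> h^-1 * (f (h + x) - f x) <= e.
  move=> h0 hd'; have := hd h; rewrite /= sub0r normrN => /(_ hd' h0).
  rewrite ltr_norml => /andP[h1 _].
  rewrite -[_ * _]/(h^-1 *: (f (h + x) - f x)).
  lra.
exists d => // u v xdu ux xv vxd.
have right : f v - f x <= e * (v - x).
  have [->|vx] := eqVneq v x; first by rewrite !subrr mulr0.
  have xltv : 0 < v - x by rewrite subr_gt0 lt_neqAle eq_sym vx.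
  rewrite -ler_pdivrMr// mulrC -{2}(subrK x v); apply: quot.
    by rewrite subr_eq0.
  by rewrite gtr0_norm//; lra.
have left : f x - f u <= e * (x - u).
  have [->|vx] := eqVneq u x; first by rewrite !subrr mulr0.
  have xltv : 0 < x - u by rewrite subr_gt0 lt_neqAle vx.
  rewrite -ler_pdivrMr// mulrC -(opprB (f u)) mulrN -mulNr -invrN opprB.
  rewrite -{2}(subrK x u); apply: quot; first by rewrite subr_eq0.
  by rewrite ltr0_norm; lra.
by rewrite !mulrBr in right left *; lra.
Qed.

(** Recasts absolute continuity for lists of intervals ordered from left to right, which can be
    extended at the right end one step at a time; the order gives disjointness. *)
Lemma abs_continuous_seq (R : realType) (f : R -> R) (a b e d : R) :
  (forall (k : nat) (I : 'I_k -> R * R),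
      (forall i, [/\ a <= (I i).1, (I i).1 <= (I i).2 & (I i).2 <= b]) ->
      trivIset setT (fun i => `](I i).1, (I i).2[%classic) ->
      \sum_(i < k) ((I i).2 - (I i).1) < d ->
      \sum_(i < k) `|f (I i).2 - f (I i).1| < e) ->
  forall s : seq (R * R),
    all (fun p => [&& a <= p.1, p.1 <= p.2 & p.2 <= b]) s ->
    pairwise (fun p q => p.2 <= q.1) s ->
    \sum_(p <- s) (p.2 - p.1) < d ->
    \sum_(p <- s) `|f p.2 - f p.1| < e.
Proof.
move=> AC s /all_nthP ins /pairwiseP pws.
rewrite !(big_nth (0, 0)) !big_mkord => sd.
apply: (AC _ (fun i => nth (0, 0) s i)) => //.
  by move=> i; have /and3P[] := ins (0, 0) i (ltn_ord i).
move=> i j _ _ [x [/=]]; rewrite !in_itv/= => /andP[xi ix] /andP[xj jx].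
apply/val_inj; case: (ltngtP i j) => //= ij; exfalso.
  by have := pws (0, 0) i j (ltn_ord i) (ltn_ord j) ij; lra.
by have := pws (0, 0) j i (ltn_ord j) (ltn_ord i) ij; lra.
Qed.

Lemma abs_continuous_le (R : realType) (f : R -> R) (a b : R) :
  a <= b -> abs_continuous a b f ->
  {ae lebesgue_measure, forall t : R, a < t < b ->
     derivable f t 1 /\ derive1 f t <= 0} ->
  f b <= f a.
Proof.
move=> ab AC df.
(* The first [e] is the slope allowed at good points, the second the total increment allowed over
   the exceptional intervals. *)
suff small e : 0 < e -> f b - f a <= e * (b - a) + e.
  have c0 : 0 < b - a + 1 by lra.
  rewrite -subr_le0; apply/ler_addgt0Pr => e e0; rewrite add0r.
  have := small (e / (b - a + 1)); rewrite divr_gt0// => /(_ isT).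
  by rewrite -[X in _ <= _ + X]mulr1 -mulrDr divfK// gt_eqF.
move=> e0.
have [d d0 ACd] := AC e e0.
have [U [oU NU mU]] : exists U : set R, [/\ open U,
    (forall t, a <= t <= b -> ~ U t -> derivable f t 1 /\ derive1 f t <= 0) &
    (lebesgue_measure U <= (d / 2)%:E)%E].
  (* The endpoints join the exceptional set, as the derivative bound is only given strictly between
     them. The radius [d / 2] leaves room for the strict inequality [< d]. *)
  have N0 : lebesgue_measure.-negligible
     (~` [set t : R | a < t < b -> derivable f t 1 /\ derive1 f t <= 0]
        `|` ([set a] `|` [set b])).
    apply: negligibleU; first exact: df.
    by apply: negligibleU; apply/negligibleP => //;
      exact: lebesgue_measure_set1.
  have d20 : 0 < d / 2 by rewrite divr_gt0.
  move/negligible_outer_measure in N0.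
  have [U [oU NU mU]] := outer_measure_open_le
     (~` [set t : R | a < t < b -> derivable f t 1 /\ derive1 f t <= 0]
        `|` ([set a] `|` [set b])) d20.
  exists U; split => //; last by rewrite N0 add0e in mU.
  move=> t /andP[at_ tb] Ut; apply: contrapT => nd; apply: Ut; apply: NU.
  have [->|ta] := eqVneq t a; first by right; left.
  have [->|tb'] := eqVneq t b; first by right; right.
  by left=> /= H; apply: nd; apply: H; rewrite !lt_neqAle eq_sym ta at_ tb' tb.
have mUo : measurable U by exact: open_measurable.
(* On [a, x], [f] grows at rate at most [e] except over finitely many disjoint
   intervals, whose total length is at most that of [U]. *)
pose P x := exists s : seq (R * R),
  [/\ all (fun p => [&& a <= p.1, p.1 <= p.2 & p.2 <= x]) s,
      pairwise (fun p q => p.2 <= q.1) s,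
      ((\sum_(p <- s) (p.2 - p.1))%:E <= lebesgue_measure (U `&` `[a, x]))%E &
      f x - f a <= e * (x - a) + \sum_(p <- s) `|f p.2 - f p.1|].
suff [s [s1 s2 s3 s4]] : P b.
  have := abs_continuous_seq ACd s1 s2; rewrite -lte_fin => /(_ _).
  suff h : ((\sum_(p <- s) (p.2 - p.1))%:E < d%:E)%E by move=> /(_ h); lra.
  apply: (le_lt_trans s3); apply: (@le_lt_trans _ _ (d / 2)%:E).
    apply: le_trans mU; apply: le_measure; rewrite ?inE//.
    exact: measurableI.
  by rewrite lte_fin; lra.
apply: (@itv_step_ind _ a) => //.
  exists [::]; split => //=; rewrite ?big_nil//.
  by rewrite !subrr mulr0 addr0.
move=> x axb.
have [Ux|nUx] := pselect (U x).
  have /nbhs_ballP [r /= r0 rU] : nbhs x U by exact: open_nbhs_nbhs.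
  exists r => // u v /andP[au ux] /andP[xv vb] ru rv [s [s1 s2 s3 s4]].
  exists (rcons s (u, v)); split.
  - rewrite all_rcons /= au lexx (le_trans ux xv)/=; apply: sub_all s1 => p /=.
    by move=> /and3P[-> -> /= pu]; rewrite (le_trans pu)// (le_trans ux).
  - by rewrite pairwise_rcons s2 andbT; apply: sub_all s1 => p /= /and3P[].
  - rewrite -cats1 big_cat big_seq1/= EFinD.
    (* The half-open interval is disjoint from [[a, u]], so its length adds to the measure already
       used. *)
    have -> : ((v - u)%:E = lebesgue_measure `]u, v])%E.
      rewrite lebesgue_measure_itv/= lte_fin; case: ltP => // vu.
      by rewrite (_ : v = u) ?subrr//; lra.
    apply: (@le_trans _ _ (lebesgue_measure ((U `&` `[a, u]) `|` `]u, v]))).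
      rewrite measureU//; last 2 first.
      + exact: measurableI.
      + rewrite -subset0 => y [[_ /=]]; rewrite !in_itv/=; lra.
      by rewrite leeD2r.
    apply: le_measure; rewrite ?inE.
    + by apply: measurableU => //; exact: measurableI.
    + exact: measurableI.
    move=> y [[Uy]|]/=; rewrite !in_itv/= => /andP[h1 h2]; split => //=.
    + by rewrite h1; lra.
    + by apply: rU; rewrite /ball/= ltr_norml; lra.
    + by rewrite h2 andbT; lra.
  - rewrite -cats1 big_cat big_seq1/=.
    have := ler_norm (f v - f u).
    have : 0 <= e * (v - u) by apply: mulr_ge0; lra.
    by move: s4; rewrite !mulrBr; lra.
have [dx fx] := NU x axb nUx.
have [r r0 hr] := derive1_le0_straddle dx fx e0.
exists r => // u v /andP[au ux] /andP[xv vb] ru rv [s [s1 s2 s3 s4]].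
exists s; split => //.
- by apply: sub_all s1 => p /and3P[-> -> /= pu]; lra.
- apply: (le_trans s3); apply: le_measure; rewrite ?inE.
  + exact: measurableI.
  + exact: measurableI.
  move=> y [Uy /=]; rewrite in_itv/= => /andP[h1 h2]; split=> //=.
  by rewrite in_itv/= h1; lra.
- have := hr u v ru ux xv rv.
  by move: s4; rewrite !mulrBr; lra.
Qed.

Lemma abs_continuousD (R : realType) (V : normedModType R) (a b : R)
    (f g : R -> V) :
  abs_continuous a b f -> abs_continuous a b g ->
  abs_continuous a b (f \+ g).
Proof.
move=> ACf ACg e e0; have e20 : 0 < e / 2 by rewrite divr_gt0.
have [d d0 fd] := ACf _ e20; have [d' d'0 gd] := ACg _ e20.
exists (Num.min d d'); first by rewrite lt_min d0.
move=> k I Iab tI; rewrite lt_min => /andP[Id Id'].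
have fs := fd k I Iab tI Id; have gs := gd k I Iab tI Id'.
rewrite [ltRHS]splitr (le_lt_trans _ (ltrD fs gs))// -big_split/=.
by apply: ler_sum => i _; rewrite opprD addrACA ler_normD.
Qed.

(** Only increments are compared: taking [f] to be the identity covers Lipschitz functions, taking
    [f] to be a trajectory covers losses along it. *)
Lemma lipschitz_abs_continuous_comp (R : realType) (V W : normedModType R)
    (a b M : R) (f : R -> V) (g : R -> W) :
  (forall u v, a <= u -> u <= v -> v <= b ->
     `|g v - g u| <= M * `|f v - f u|) ->
  abs_continuous a b f -> abs_continuous a b g.
Proof.
move=> lip ACf e e0.
(* [M] may be zero or negative, so a positive majorant is used as the divisor. *)
have M0 : 0 < `|M| + 1 by rewrite ltr_wpDl.
have [d d0 fd] := ACf _ (divr_gt0 e0 M0).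
exists d => // k I Iab tI Id; have := fd k I Iab tI Id.
rewrite ltr_pdivlMr// => /(le_lt_trans _); apply.
rewrite mulr_suml; apply: ler_sum => i _; have [h1 h2 h3] := Iab i.
rewrite (le_trans (lip _ _ h1 h2 h3))// mulrC ler_wpM2l//.
by rewrite (le_trans (ler_norm _))// lerDl.
Qed.

Lemma abs_continuous_id (R : realType) (a b : R) :
  abs_continuous a b (@idfun R).
Proof.
move=> e e0; exists e => // k I Iab _; apply: le_lt_trans.
by apply: ler_sum => i _; have [_ h _] := Iab i; rewrite ger0_norm ?subr_ge0.
Qed.

(** The bound [M] makes the primitive of [g] Lipschitz, hence absolutely continuous; its derivative
    is [g] almost everywhere, so [f] plus this primitive is nonincreasing. *)
Lemma Rintegral_le_of_derive1_le (R : realType) (f g : R -> R) (a b M : R) :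
  a <= b -> abs_continuous a b f ->
  lebesgue_measure.-integrable [set: R] (EFin \o g) ->
  (forall x, 0 <= g x <= M) ->
  {ae lebesgue_measure, forall t : R, a < t < b ->
     derivable f t 1 /\ derive1 f t <= - g t} ->
  \int[lebesgue_measure]_(t in `[a, b]) g t <= f a - f b.
Proof.
move=> ab ACf intg gM df.
pose F x := \int[lebesgue_measure]_(t in `[a, x]) g t.
have intgS (D : set R) : measurable D ->
    lebesgue_measure.-integrable D (EFin \o g).
  by move=> mD; apply: integrableS intg.
have M0 : 0 <= M by have /andP[] := gM a; exact: le_trans.
have lipF u v : a <= u -> u <= v -> v <= b -> `|F v - F u| <= M * `|v - u|.
  move=> au uv vb.
  rewrite /F (@Rintegral_itvB _ g (BLeft a) (BRight v)) ?bnd_simp//; last first.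
    exact: intgS.
  rewrite ger0_norm; last by apply: Rintegral_ge0 => x _; have /andP[] := gM x.
  have lv : lebesgue_measure `]u, v] = (v - u)%:E :> \bar R.
    rewrite lebesgue_measure_itv/= lte_fin; case: ltP => // vu.
    by rewrite (_ : v = u) ?subrr//; lra.
  apply: (@le_trans _ _ (\int[lebesgue_measure]_(x in `]u, v]) M)).
    apply: le_Rintegral => //.
    - exact: intgS.
    - apply: measurable_bounded_integrable => //; first by rewrite /= lv ltry.
      by exists `|M|; split; [exact: num_real|move=> x Mx y _ /=; exact: ltW].
    - by move=> x _; have /andP[] := gM x.
  by rewrite Rintegral_cst//= lv/= ger0_norm// subr_ge0.
have ACF : abs_continuous a b F.
  exact: lipschitz_abs_continuous_comp lipF (@abs_continuous_id _ a b).
have Fa0 : F a = 0 by rewrite /F set_itv1 Rintegral_set1.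
have dF := @FTC1 R g (BLeft a) (fun y => intgS _ (measurable_itv _))
  (open_integrable_locally openT intg).
suff : (f \+ F) b <= (f \+ F) a by rewrite /= Fa0 addr0 -/(F b); lra.
apply: (abs_continuous_le ab); first exact: abs_continuousD.
move: dF df; apply: filterS2.
  exact: (ae_filter_ringOfSetsType (@lebesgue_measure R)).
move=> t dFt dft /andP[at_ tb].
have [|dF F't] := dFt; first by rewrite lte_fin.
have [df f't] := dft (introT andP (conj at_ tb)).
split; first exact: derivableD.
rewrite derive1E deriveD// -!derive1E F't; lra.
Qed.

(** * Integration of a differential inequality *)

(** The Lebesgue sigma-algebra is the completion of the Borel one: [E] is a Borel set joined with a
    negligible set, which subadditivity discards. *)
Lemma lebesgue_measurable_borel_inner (R : realType)
    (E : set (lebesgueTypeR R)) : measurable E ->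
  exists A : set R, [/\ measurable A, A `<=` E &
    completed_lebesgue_measure E = lebesgue_measure A].
Proof.
move=> mE.
have : (measurable_realfun.completed_algebra_gen
    (@lebesgue_measure R)).-sigma.-measurable E.
  by rewrite completed_caratheodory_measurable.
rewrite g_sigma_completed_algebra_genE => -[A /= mA [N N0 ANE]].
exists A; split => //; first by rewrite -ANE; exact: subsetUl.
move/negligible_outer_measure in N0.
apply/eqP; rewrite -ANE eq_le; apply/andP; split; last first.
  by apply: le_outer_measure; exact: subsetUl.
rewrite -[leRHS]adde0 -[X in (_ <= _ + X)%E]N0.
exact: outer_measureU2.
Qed.

Import HBNNSimple.

(** Each fibre of [h] is shrunk to a Borel subset of equal measure. This passes from the completed
    measure, used to integrate [alpha], to Borel functions, to which Lebesgue differentiation is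
    applied. *)
Lemma nnsfun_borel_minorant (R : realType)
    (h : {nnsfun lebesgueTypeR R >-> R}) :
  exists g : R -> R, [/\ measurable_fun [set: R] g,
    forall x : R, 0 <= g x <= h x &
    sintegral completed_lebesgue_measure h =
    (\int[lebesgue_measure]_x (g x)%:E)%E].
Proof.
have /choice[A AP] : forall r : R, exists A : set R, [/\ measurable A,
    A `<=` h @^-1` [set r] &
    completed_lebesgue_measure (h @^-1` [set r]) = lebesgue_measure A].
  by move=> r; apply: lebesgue_measurable_borel_inner; exact: measurable_funPTI.
have mA r : measurable (A r) by case: (AP r).
have Ah r : A r `<=` h @^-1` [set r] by case: (AP r).
(* For [r < 0] the set [A r] is empty because [h] is nonnegative. *)
have rA0 r x : 0 <= r * \1_(A r) x.
  rewrite indicE; case: (boolP (x \in A r)) => [|_]; last by rewrite mulr0.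
  by move=> /set_mem /Ah <-; rewrite mulr1; exact: fun_ge0.
have mrA r : measurable_fun [set: R] (fun x => r * \1_(A r) x).
  by apply: measurable_funM => //; exact: measurable_indic.
exists (fun x => \sum_(r <- fset_set (range h)) r * \1_(A r) x); split.
- exact: measurable_sum.
- move=> x; rewrite sumr_ge0//= fimfunE fsbig_finite//=.
  apply: ler_sum => r _; have [xA|xA] := boolP (x \in A r).
    by rewrite !indicE xA mem_set//; apply: Ah; exact: set_mem xA.
  rewrite [X in _ * X]indicE (negPf xA) mulr0 indicE.
  have [|_] := boolP (x \in _); last by rewrite mulr0.
  by move=> /set_mem <-; rewrite mulr1; exact: fun_ge0.
under eq_integral do rewrite -sumEFin.
rewrite ge0_integral_sum//; last 2 first.
- by move=> r; apply/measurable_EFinP; exact: mrA.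
- by move=> r x _; rewrite lee_fin.
rewrite sintegralE fsbig_finite//=; apply: eq_big_seq => r.
rewrite in_fset_set// => /set_mem[x _ hxr].
have r0 : 0 <= r by rewrite -hxr; exact: fun_ge0.
under eq_integral do rewrite EFinM.
rewrite ge0_integralZl_EFin//; last first.
  by apply/measurable_EFinP; apply: measurable_indic; exact: mA.
rewrite integral_indic//; last exact: mA.
by rewrite (setIT (A r : set R)); have [_ _ ->] := AP r.
Qed.

Lemma integral_le_of_derive1_le (R : realType) (f h : R -> R) (a b : R) :
  a <= b -> abs_continuous a b f ->
  (forall t, a <= t <= b -> 0 <= h t) ->
  {ae lebesgue_measure, forall t : R, a < t < b ->
     derivable f t 1 /\ derive1 f t <= - h t} ->
  (\int[completed_lebesgue_measure]_(t in `[a, b]) (h t)%:E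
    <= (f a - f b)%:E)%E.
Proof.
move=> ab ACf h0 df.
rewrite ge0_integralE; last first.
  by move=> t /=; rewrite in_itv/= lee_fin; exact: h0.
(* It suffices to treat one simple function [s] below the extension of [h] by zero; its Borel
   minorant [g] has the same integral. *)
apply: ge_ereal_sup => _ [s /= sh <-].
have [g [mg gs ->]] := nnsfun_borel_minorant s.
have sE t : s t <= h t * \1_`[a, b] t.
  have := sh t; rewrite patchE indicE.
  by case: ifP => _; rewrite lee_fin ?mulr1 ?mulr0.
have [M sM] : exists M, forall t, s t <= M.
  have [M [_ sM]] := simple_bounded s.
  (* Boundedness provides a bound at every number strictly above [M], hence the shift by one. *)
  exists (M + 1) => t; apply: le_trans (ler_norm _) _.
  by apply: (sM (M + 1)); rewrite ?ltrDl.
have gM t : 0 <= g t <= M.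
  by have /andP[-> /le_trans] := gs t; apply; exact: sM.
have gh t : a < t < b -> g t <= h t.
  move=> /andP[at_ tb]; have /andP[_ /le_trans] := gs t; apply.
  have := sE t; rewrite indicE mem_set ?mulr1// /= in_itv/=.
  by rewrite !ltW.
have g0 t : ~ `[a, b]%classic t -> g t = 0.
  move=> abt; apply/eqP; rewrite eq_le; have /andP[-> gst] := gs t.
  by rewrite andbT (le_trans gst)// (le_trans (sE t))// indicE memNset// mulr0.
have gE : g = g \_ `[a, b].
  apply/funext => t; rewrite patchE; case: ifPn => //.
  by move=> /negP abt; apply: g0 => ?; apply: abt; exact: mem_set.
have intg : lebesgue_measure.-integrable [set: R] (EFin \o g).
  rewrite gE -restrict_EFin -integrable_mkcond//.
  apply: measurable_bounded_integrable => //.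
  - rewrite /= lebesgue_measure_itv/=; case: ifP => // _.
    by rewrite -EFinB ltry.
  - exact: measurable_funS mg.
  - exists M; split; first exact: num_real.
    move=> x Mx t _ /=; have /andP[gt0 gtM] := gM t.
    by rewrite ger0_norm// (le_trans gtM)// ltW.
have -> : (\int[lebesgue_measure]_t (g t)%:E =
    (\int[lebesgue_measure]_(t in `[a, b]) g t)%:E)%E.
  rewrite /Rintegral fineK; last first.
    by apply: integrable_fin_num => //; exact: integrableS intg.
  rewrite [RHS]integral_mkcond; apply: eq_integral => t _.
  by rewrite [in LHS]gE -[LHS]/((EFin \o (g \_ `[a, b])) t) -restrict_EFin.
rewrite lee_fin; apply: (Rintegral_le_of_derive1_le ab ACf intg gM).
move: df; apply: filterS.
  exact: (ae_filter_ringOfSetsType (@lebesgue_measure R)).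
move=> t dft abt; have [dt f't] := dft abt; split => //.
by rewrite (le_trans f't)// lerN2 gh.
Qed.

(** * Continuously differentiable functions along curves *)

Lemma diff_dotp_grad (R : realType) (n : nat) (f : 'rV[R]_n -> R)
    (x v : 'rV[R]_n) :
  differentiable f x -> 'd f x v = dotp (grad f x) v.
Proof.
move=> df; rewrite [in LHS](row_sum_delta v) linear_sum/=.
apply: eq_bigr => j _; rewrite linearZ/= mxE mulrC deriveE//.
Qed.

Lemma is_derive1_comp_grad (R : realType) (n : nat) (f : 'rV[R]_n -> R)
    (c : R -> 'rV[R]_n) (t : R) (w : 'rV[R]_n) :
  differentiable f (c t) -> is_derive t (1 : R) c w ->
  is_derive t (1 : R) (f \o c) (dotp (grad f (c t)) w).
Proof.
move=> df dc; have [/derivable1_diffP dct cw] := dc.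
apply: DeriveDef.
  by apply/derivable1_diffP; exact: differentiable_comp.
rewrite deriveE; last exact: differentiable_comp.
by rewrite diff_comp//= -[X in 'd f _ X]deriveE// cw diff_dotp_grad.
Qed.

Lemma coord_le_norm (R : realType) (n : nat) (x : 'rV[R]_n) (j : 'I_n) :
  `|x 0 j| <= `|x|.
Proof.
rewrite [leRHS]/Num.norm /= mx_normrE.
by apply: (le_bigmax _ (fun i : 'I_1 * 'I_n => `|x i.1 i.2|) (0, j)).
Qed.

(** The factor [n] comes from the sup norm: each of the [n] coordinate products is at most the
    product of the norms. *)
Lemma dotp_le (R : realType) (n : nat) (u v : 'rV[R]_n) :
  `|dotp u v| <= n%:R * `|u| * `|v|.
Proof.
rewrite -mulrA mulr_natl -[X in _ *+ X](card_ord n) -sumr_const.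
rewrite (le_trans (ler_norm_sum _ _ _))//; apply: ler_sum => j _.
by rewrite normrM ler_pM// coord_le_norm.
Qed.

(** The gradient is bounded on the compact ball, and the mean value theorem applies along the
    segment from [x] to [y], which stays in the ball by convexity. *)
Lemma C1_lipschitz_ball (R : realType) (n : nat) (f : 'rV[R]_n -> R) (r : R) :
  C1 f -> exists M, forall x y, `|x| <= r -> `|y| <= r ->
    `|f y - f x| <= M * `|y - x|.
Proof.
move=> [df cf].
pose K := [set x : 'rV[R]_n | `|x| <= r].
have [M gM] : exists M, forall x, K x -> `|grad f x| <= M.
  (* For negative [r] the ball is empty; otherwise it contains [0], and the maximum of the gradient
     norm exists. *)
  have [r0|r0] := ltP r 0.
    by exists 0 => x Kx; have := le_lt_trans Kx r0; rewrite normr_lt0.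
  have cK : compact K.
    apply: bounded_closed_compact.
      exists r; split; first exact: num_real.
      by move=> M rM x Kx /=; rewrite (le_trans Kx)// ltW.
    apply: (@closed_comp _ _ (fun x : 'rV[R]_n => `|x|) [set y | y <= r]).
      by move=> x _; exact: norm_continuous.
    exact: closed_le.
  have K0 : K !=set0 by exists 0; rewrite /K/= normr0.
  have [|c _ cmax] := @EVT_max_rV R n (fun x => `|grad f x|) K K0 cK.
    apply: continuous_subspaceT => x.
    by apply: continuous_comp; [exact: cf|exact: norm_continuous].
  by exists `|grad f c| => x Kx; apply: cmax; exact: mem_set.
exists (n%:R * M) => x y xr yr.
pose c (s : R) := x + s *: (y - x).
have dc s : is_derive s (1 : R) c (y - x).
  have dl : is_derive s (1 : R) ( *:%R^~ (y - x)) (y - x).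
    apply: DeriveDef; first exact/derivable1_diffP.
    by rewrite deriveE// diff_val scale1r.
  by rewrite -[X in is_derive _ _ _ X]add0r; exact: (is_deriveD (f := cst x)).
have dfc s : is_derive s (1 : R) (f \o c) (dotp (grad f (c s)) (y - x)).
  exact: is_derive1_comp_grad.
have cr s : s \in `[0, 1] -> `|c s| <= r.
  rewrite in_itv/= => /andP[s0 s1].
  have -> : c s = (1 - s) *: x + s *: y.
    by rewrite /c scalerBr scalerBl scale1r addrA addrAC.
  rewrite (le_trans (ler_normD _ _))// !normrZ !ger0_norm ?subr_ge0//.
  apply: (@le_trans _ _ ((1 - s) * r + s * r)); last by lra.
  by rewrite lerD// ler_wpM2l// subr_ge0.
have [|s s01] := MVT_segment ler01 (fun s _ => dfc s).
  by apply: derivable_within_continuous => s _; have [] := dfc s.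
rewrite /= /c scale0r scale1r addr0 subrKC subr0 mulr1 => ->.
rewrite (le_trans (dotp_le _ _))// ler_wpM2r// ler_wpM2l//.
by apply: gM; exact: cr.
Qed.

(** * The function [g] along a curve *)

Lemma continuous_sum (R : realType) (T : topologicalType) (k : nat)
    (f : 'I_k -> T -> R) :
  (forall i, continuous (f i)) -> continuous (fun x => \sum_(i < k) f i x).
Proof.
by move=> cf; apply: continuous_big => //; exact: add_continuous.
Qed.

(** The constraints are closed, and nonnegative coordinates with sum 1 lie in [[0, 1]], so the
    simplex is a closed subset of a cube. *)
Lemma simplex_compact (R : realType) (m : nat) : compact (@simplex R m).
Proof.
have cube : compact [set w : 'rV[R]_m | forall i, w ord0 i \in `[0, 1]].
  apply: (@rV_compact _ _ (fun=> `[0 : R, 1]%classic)) => _.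
  exact: segment_compact.
apply: (subclosed_compact _ cube).
  apply: closedI.
    rewrite [X in closed X](_ : _ =
        \bigcap_i [set w : 'rV[R]_m | 0 <= w 0 i]); last first.
      by apply/seteqP; split => [w w0 i _|w w0 i]; [exact: w0|exact: w0 i I].
    apply: closed_bigI => i _.
    apply: (@closed_comp _ _ (fun w : 'rV[R]_m => w 0 i) [set y | 0 <= y]).
      by move=> w _; exact: coord_continuous.
    exact: closed_ge.
  apply: (@closed_comp _ _ (fun w : 'rV[R]_m => \sum_(i < m) w 0 i) [set 1]).
    by move=> w _; apply: continuous_sum => i; exact: coord_continuous.
  exact: closed_eq.
move=> w [w0 w1] i; rewrite in_itv/= w0/= -w1 (bigD1 i)//= lerDl.
by apply: sumr_ge0 => j _.
Qed.

Lemma simplex_nonempty (R : realType) (m : nat) :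
  (0 < m)%N -> @simplex R m !=set0.
Proof.
move=> m0; exists (delta_mx 0 (Ordinal m0)); split.
  by move=> i; rewrite mxE ler0n.
rewrite (bigD1 (Ordinal m0))//= mxE !eqxx big1 ?addr0// => i im.
by rewrite mxE (negPf im) andbF.
Qed.

Lemma enorm_sqr (R : realType) (n : nat) (u : 'rV[R]_n) :
  enorm u ^+ 2 = dotp u u.
Proof. by rewrite sqr_sqrtr// sumr_ge0// => j _; rewrite -expr2 sqr_ge0. Qed.

(** The objective minimised in [gfun], as a function of point and weights together so that joint
    continuity can be stated. *)
Definition wgrad_sqr (R : realType) (n m : nat) (l : 'I_m -> 'rV[R]_n -> R)
  (x : 'rV[R]_n) (w : 'rV[R]_m) : R :=
  enorm (\sum_(i < m) w 0 i *: grad (l i) x) ^+ 2.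

Lemma wgrad_sqr_continuous (R : realType) (n m : nat)
    (l : 'I_m -> 'rV[R]_n -> R) (T : topologicalType)
    (x : T -> 'rV[R]_n) (w : T -> 'rV[R]_m) :
  (forall i, C1 (l i)) -> continuous x -> continuous w ->
  continuous (fun p => wgrad_sqr l (x p) (w p)).
Proof.
move=> l_C1 cx cw.
have coord j : continuous (fun p =>
    (\sum_(i < m) w p 0 i *: grad (l i) (x p)) 0 j : R).
  rewrite (_ : (fun p => _) = (fun p =>
      \sum_(i < m) w p 0 i * grad (l i) (x p) 0 j)); last first.
    by apply/funext => p; rewrite summxE; apply: eq_bigr => i _; rewrite mxE.
  apply: continuous_sum => i p; apply: cvgM.
    by apply: (@continuous_comp _ _ _ w (fun v : 'rV[R]_m => v 0 i));
      [exact: cw|exact: coord_continuous].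
  apply: (@continuous_comp _ _ _ (fun p => grad (l i) (x p))
    (fun v : 'rV[R]_n => v 0 j)); last exact: coord_continuous.
  by apply: (@continuous_comp _ _ _ x); [exact: cx|exact: (l_C1 i).2].
rewrite /wgrad_sqr; under eq_fun do rewrite enorm_sqr /dotp.
by apply: continuous_sum => j p; apply: cvgM; exact: coord.
Qed.

Section gfun_theory.
Variables (R : realType) (n m : nat) (l : 'I_m -> 'rV[R]_n -> R).
Hypotheses (m_gt0 : (0 < m)%N) (l_C1 : forall i, C1 (l i)).

(** A continuous objective on the compact nonempty simplex attains its minimum, so the default value
    in [minimum] is not taken. *)
Lemma gfun_minima (x : 'rV[R]_n) :
  minima [set wgrad_sqr l x w | w in @simplex R m] (gfun l x).
Proof.
apply: xgetPex.
have [|w sw wmin] := EVT_min_rV (f := wgrad_sqr l x) (simplex_nonempty R m_gt0)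
    (@simplex_compact R m).
  apply: continuous_subspaceT.
  apply: (wgrad_sqr_continuous (x := cst x) (w := idfun)) => // p.
    exact: cst_continuous.
  exact: cvg_id.
exists (wgrad_sqr l x w); split.
  by exists w => //; exact: set_mem.
by move=> _ [w' sw' <-]; apply: wmin; exact: mem_set.
Qed.

Lemma gfun_attained (x : 'rV[R]_n) :
  exists2 w, @simplex R m w & gfun l x = wgrad_sqr l x w.
Proof. by have [[w sw gw] _] := gfun_minima x; exists w. Qed.

Lemma gfun_le (x : 'rV[R]_n) (w : 'rV[R]_m) :
  @simplex R m w -> gfun l x <= wgrad_sqr l x w.
Proof. by move=> sw; have [_] := gfun_minima x; apply; exists w. Qed.

Variable c : R -> 'rV[R]_n.
Hypothesis c_cont : continuous c.

(** Time and weights are treated jointly: [g] along the curve is the partial minimum over the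
    weights of this continuous function on a compact cylinder. *)
Let Q (p : R * 'rV[R]_m) := wgrad_sqr l (c p.1) p.2.

Let Q_continuous : continuous Q.
Proof.
apply: wgrad_sqr_continuous => // p; last exact: cvg_snd.
by apply: (@continuous_comp _ _ _ fst); [exact: cvg_fst|exact: c_cont].
Qed.

Let cylinder_compact (a b : R) :
  compact (`[a, b]%classic `*` @simplex R m).
Proof. exact: compact_setX (@segment_compact _ _ _) (@simplex_compact _ _). Qed.

(** The time component of a joint minimiser of [Q] works: [g] there is at most the minimum of [Q],
    and every value of [g] on the curve is a value of [Q]. *)
Lemma gfun_curve_min (a b : R) : a <= b ->
  exists2 s, a <= s <= b &
    forall u, a <= u <= b -> gfun l (c s) <= gfun l (c u).
Proof.
move=> ab; have [w0 sw0] := simplex_nonempty R m_gt0.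
have [|[s w] /set_mem[/= sab sw] Qmin] :=
    compact_EVT_min (f := Q) _ (@cylinder_compact a b)
      (continuous_subspaceT Q_continuous).
  by exists (a, w0); split => //=; rewrite in_itv/= lexx.
exists s; first by move: sab; rewrite in_itv.
move=> u uab; have [w' sw' ->] := gfun_attained (c u).
apply: le_trans (gfun_le _ sw) _; apply: (Qmin (u, w')).
by apply: mem_set; split.
Qed.

(** This is the last visit to a sublevel set of [g]. The visiting times are the projection of a
    compact sublevel set of [Q], so they have a greatest element. *)
Lemma gfun_curve_last (a b e : R) : a <= b -> gfun l (c a) <= e ->
  exists s, [/\ a <= s <= b, gfun l (c s) <= e &
    forall u, s < u <= b -> e < gfun l (c u)].
Proof.
move=> ab gae.
pose K := (`[a, b]%classic `*` @simplex R m) `&` [set p | Q p <= e].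
have cK : compact K.
  apply: compact_closedI; first exact: cylinder_compact.
  apply: (@closed_comp _ _ Q [set y | y <= e]) => [p _|]; last exact: closed_le.
  exact: Q_continuous.
have K_intro u w : a <= u <= b -> @simplex R m w -> gfun l (c u) <= e ->
    wgrad_sqr l (c u) w = gfun l (c u) -> K (u, w).
  by move=> uab sw gu Qu; split; [split|rewrite /= /Q/= Qu].
have [w0 sw0 gaE] := gfun_attained (c a).
have [||[s w] /set_mem[[/= sab sw] Qs] smax] :=
    compact_EVT_max (f := fst) (A := K) _ cK.
- by exists (a, w0); apply: K_intro => //; rewrite lexx.
- by apply: continuous_subspaceT => p; exact: cvg_fst.
rewrite in_itv/= in sab.
have gs : gfun l (c s) <= e by apply: le_trans Qs; exact: gfun_le.
exists s; split => // u /andP[su ub]; rewrite ltNge; apply/negP => gu.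
have [w' sw' gwE] := gfun_attained (c u).
have uab : a <= u <= b.
  by move: sab => /andP[as_ _]; rewrite ub (le_trans as_ (ltW su)).
have Kuw : K (u, w') by apply: K_intro.
by have := smax (u, w') (mem_set Kuw); rewrite /= leNgt su.
Qed.

End gfun_theory.

(** Absolute continuity for a single interval is uniform continuity on [[a, b]], and clamping to
    [[a, b]] is monotone and 1-Lipschitz. *)
Lemma clamp_continuous (R : realType) (V : normedModType R) (a b : R)
    (f : R -> V) :
  a <= b -> abs_continuous a b f ->
  continuous (fun s => f (Num.max a (Num.min s b))).
Proof.
move=> ab ACf s; apply/cvgrPdist_lt => e e0.
have [d d0 fd] := ACf e e0.
have close u v : a <= u -> u <= v -> v <= b -> v - u < d -> `|f v - f u| < e.
  move=> au uv vb vud; have := fd 1%N (fun=> (u, v)).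
  rewrite !big_ord1/=; apply => //.
  by move=> i j _ _ _; rewrite (ord1 i) (ord1 j).
pose k (t : R) := Num.max a (Num.min t b).
have ka t : a <= k t by rewrite /k le_max lexx.
have kb t : k t <= b by rewrite /k ge_max ab ge_min lexx orbT.
have k_mono t t' : t <= t' -> k t <= k t'.
  move=> tt'; rewrite /k.
  by case: (leP t b); case: (leP t' b); case: (leP a t); case: (leP a t');
    case: (leP a b); lra.
have k_lip t t' : t <= t' -> k t' - k t <= t' - t.
  move=> tt'; rewrite /k.
  by case: (leP t b); case: (leP t' b); case: (leP a t); case: (leP a t');
    case: (leP a b); lra.
have /cvgrPdist_lt/(_ _ d0) near_s : id x @[x --> s] --> s by exact: cvg_id.
near=> t.
have std : `|s - t| < d by near: t.
have [st|ts] := leP s t.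
  rewrite distrC; apply: close; rewrite ?ka ?kb ?k_mono//.
  by rewrite (le_lt_trans (k_lip _ _ st))//; move: std; rewrite ltr_norml; lra.
have {}ts := ltW ts.
apply: close; rewrite ?ka ?kb ?k_mono//.
by rewrite (le_lt_trans (k_lip _ _ ts))//; move: std; rewrite ltr_norml; lra.
Unshelve. all: by end_near. Qed.

(** * The Pareto navigation flow *)

Lemma borel_lebesgue_measurable (R : realType) (A : set R) :
  measurable A -> measurable (A : set (lebesgueTypeR R)).
Proof. by move=> mA; exact: sub_caratheodory. Qed.

(** Monotone convergence along the intervals [[0, k]]; aiming at [B + 1] yields the strict
    inequality. *)
Lemma ge0_integral_ray_pinfty (R : realType) (h : R -> R) (B : R) :
  measurable_fun (`[0, +oo[%classic : set (lebesgueTypeR R))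
    (h : lebesgueTypeR R -> R) ->
  (forall t, 0 <= t -> 0 <= h t) ->
  (\int[completed_lebesgue_measure]_(t in `[0%R, +oo[) (h t)%:E = +oo)%E ->
  exists2 t, 0 <= t &
    (B%:E < \int[completed_lebesgue_measure]_(s in `[0%R, t]) (h s)%:E)%E.
Proof.
move=> mh h0 hoo.
pose D (k : nat) : set (lebesgueTypeR R) := `[0, k%:R]%classic.
have DE : \bigcup_k D k = `[0, +oo[%classic.
  apply/seteqP; split => [t [k _]|t]; rewrite /D/= !in_itv/= ?andbT.
    by move=> /andP[].
  move=> t0; exists (Num.trunc t).+1 => //=; rewrite in_itv/= t0.
  by rewrite ltW// truncnS_gt.
have : (\int[completed_lebesgue_measure]_(t in D k) (h t)%:E)%E @[k --> \oo] -->
    (\int[completed_lebesgue_measure]_(t in \bigcup_k D k) (h t)%:E)%E.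
  apply: ge0_nondecreasing_set_cvg_integral.
  - move=> j k jk; apply/subsetPset => t; rewrite /D/= !in_itv/=.
    by move=> /andP[-> /le_trans]; apply; rewrite ler_nat.
  - move=> k; apply: borel_lebesgue_measurable; exact: measurable_itv.
  - move=> k; apply/measurable_EFinP; apply: measurable_funS mh.
      by apply: borel_lebesgue_measurable; exact: measurable_itv.
    by move=> t; rewrite /D/= !in_itv/= andbT => /andP[].
  - by move=> k t; rewrite /D/= in_itv/= => /andP[t0 _]; rewrite lee_fin h0.
rewrite DE hoo => /cvgey_ge /(_ (B + 1)) [k _ /(_ k (leqnn k)) hk].
exists k%:R => //.
by apply: lt_le_trans hk; rewrite lte_fin ltrDl.
Qed.

Lemma minimum_finite_range (R : realType) (m : nat) (f : 'I_m -> R) :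
  (0 < m)%N -> exists i, minimum (range f) = f i.
Proof.
move=> m0; suff : exists y, minima (range f) y.
  by move=> /(xgetPex 0)[[i _ fi] _]; exists i.
have [i _ imin] := arg_minP f (erefl : xpredT (Ordinal m0)).
by exists (f i); split; [exists i|move=> _ [j _ <-]; exact: imin].
Qed.

Section flow_theory.
Variables (R : realType) (n m : nat) (m_gt0 : (0 < m)%N).
Variables (F : 'rV[R]_n -> R) (l : 'I_m -> 'rV[R]_n -> R) (e : R).
Variables (alpha : R -> R) (theta : R -> 'rV[R]_n).
Hypothesis l_C1 : forall i, C1 (l i).
Hypothesis e_gt0 : 0 < e.
Hypothesis alpha_ge0 : forall t : R, 0 <= t -> 0 <= alpha t.
Hypothesis alpha_meas :
  measurable_fun (`[0, +oo[%classic : set (lebesgueTypeR R))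
    (alpha : lebesgueTypeR R -> R).
Hypothesis flow : pareto_flow F l e alpha theta.

Lemma flow_derive1_le : {ae lebesgue_measure, forall t : R, 0 <= t ->
  ~ pareto l e (theta t) -> forall i, derivable (l i \o theta) t 1 /\
    derive1 (l i \o theta) t <= - (alpha t * gfun l (theta t))}.
Proof.
have [_] := flow; apply: filterS.
  exact: (ae_filter_ringOfSetsType (@lebesgue_measure R)).
move=> t + t0 Pt i => /(_ t0)[/(_ Pt)[v [feas _] dv] _ _].
have [dl lE] := is_derive1_comp_grad ((l_C1 i).1 (theta t)) dv.
split => //; rewrite derive1E lE.
(* Outside [pareto l e] the control takes its finite branch, so feasibility is a real inequality. *)
have := feas i; rewrite /control ifF; last by apply/negP.
rewrite lee_fin -lerN2 => /(le_trans _); apply.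
rewrite /dotp -sumrN; apply: ler_sum => j _.
by rewrite [X in _ * X <= _]mxE mulrN.
Qed.

(* [theta] is only constrained on [0, +oo); freezing it outside [0, T] gives a
   curve which is continuous on all of [R]. *)
Let curve (T : R) (s : R) := theta (Num.max 0 (Num.min s T)).

Let curveE (T s : R) : 0 <= s <= T -> curve T s = theta s.
Proof. by move=> /andP[s0 sT]; rewrite /curve min_l// max_r. Qed.

Let curve_cont (T : R) : 0 <= T -> continuous (curve T).
Proof. by move=> T0; apply: clamp_continuous => //; exact: flow.1. Qed.

(** On [[0, b]] the trajectory stays in a ball, where the loss is Lipschitz; increments of the loss
    are thus dominated by those of [theta]. *)
Lemma flow_loss_abs_continuous (i : 'I_m) (a b : R) :
  0 <= a -> a <= b -> abs_continuous a b (l i \o theta).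
Proof.
move=> a0 ab; have b0 := le_trans a0 ab.
have [|s _ smax] := @EVT_max R (fun s => `|curve b s|) 0 b b0.
  apply: continuous_subspaceT => s.
  by apply: continuous_comp; [exact: curve_cont|exact: norm_continuous].
have [M lipM] := C1_lipschitz_ball `|curve b s| (l_C1 i).
have bound u : 0 <= u <= b -> `|theta u| <= `|curve b s|.
  by move=> ub; rewrite -(curveE ub); apply: smax; rewrite in_itv.
apply: (@lipschitz_abs_continuous_comp _ _ _ a b M theta).
  move=> u v au uv vb; have u0 := le_trans a0 au.
  by apply: lipM; apply: bound; rewrite ?u0 ?(le_trans uv)// (le_trans u0).
move=> d d0; have [r r0 rd] := flow.1 b b0 d d0.
exists r => // k I Iab; apply: rd => j; have [h1 h2 h3] := Iab j.
by split=> //; exact: le_trans h1.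
Qed.

(** The bound [d] on [g] turns the decay rate into [d * alpha], which is integrated. Positive [d]
    gives the rate and the hitting time, [d = 0] gives monotonicity. Assuming the bound strictly
    inside only allows [a] to be the last visit to a sublevel set. *)
Lemma flow_loss_decrease (i : 'I_m) (a b d : R) :
  0 <= a -> a <= b -> 0 <= d ->
  (forall s, a < s < b -> d <= gfun l (theta s) /\ ~ pareto l e (theta s)) ->
  (d%:E * \int[completed_lebesgue_measure]_(s in `[a, b]) (alpha s)%:E
    <= (l i (theta a) - l i (theta b))%:E)%E.
Proof.
move=> a0 ab d0 dg.
rewrite -ge0_integralZl_EFin//; last 3 first.
- by apply: borel_lebesgue_measurable; exact: measurable_itv.
- move=> s /=; rewrite in_itv/= lee_fin => /andP[as_ _].
  by apply: alpha_ge0; exact: le_trans as_.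
- apply/measurable_EFinP; apply: measurable_funS alpha_meas.
    by apply: borel_lebesgue_measurable; exact: measurable_itv.
  by move=> s /=; rewrite !in_itv/= andbT => /andP[/(le_trans a0)].
under eq_integral do rewrite -EFinM.
apply: (integral_le_of_derive1_le (f := l i \o theta)) => //.
- exact: flow_loss_abs_continuous.
- move=> s /andP[as_ _]; rewrite mulr_ge0// alpha_ge0//.
  exact: le_trans as_.
have := flow_derive1_le; apply: filterS.
  exact: (ae_filter_ringOfSetsType (@lebesgue_measure R)).
move=> s ds /[dup] asb /andP[/ltW /(le_trans a0) s0 _].
have [dgs Ps] := dg s asb; have [dl dle] := ds s0 Ps i.
split=> //; rewrite (le_trans dle)// lerN2 mulrC.
by apply: ler_wpM2l => //; exact: alpha_ge0.
Qed.

Lemma flow_gfun_min (t : R) : 0 <= t ->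
  exists2 s, 0 <= s <= t &
    forall u, 0 <= u <= t -> gfun l (theta s) <= gfun l (theta u).
Proof.
move=> t0; have [s st smin] := gfun_curve_min m_gt0 l_C1 (curve_cont t0) t0.
exists s; first exact: st.
move=> u ut; have := smin u ut.
rewrite (curveE st) (curveE ut); exact.
Qed.

Lemma flow_pareto_closure (eps s t : R) : e < eps -> 0 <= s -> s <= t ->
  pareto l eps (theta s) -> pareto_closure l eps (theta t).
Proof.
move=> e_eps s0 st Ps; have t0 := le_trans s0 st.
have gs : gfun l (curve t s) <= eps by rewrite curveE ?s0.
have [r [/andP[sr rt] gr glast]] :=
  gfun_curve_last m_gt0 l_C1 (curve_cont t0) st gs.
have r0 := le_trans s0 sr; rewrite curveE ?r0// in gr.
exists (theta r) => // i.
have gt_eps u : r < u < t -> 0 <= gfun l (theta u) /\ ~ pareto l e (theta u).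
  move=> /andP[ru ut].
  have epsu : eps < gfun l (theta u).
    have u0t : 0 <= u <= t by rewrite (le_trans r0 (ltW ru)) (ltW ut).
    by rewrite -(curveE u0t); apply: glast; rewrite ru (ltW ut).
  have eg := lt_trans e_eps epsu; split.
    by apply: ltW; exact: lt_trans eg.
  by move=> /(lt_le_trans eg); rewrite ltxx.
(* With [d = 0] the left side vanishes even if the integral of [alpha] is infinite, leaving the
   comparison of the losses at [t] and [r]. *)
have := flow_loss_decrease i r0 rt (lexx 0) gt_eps.
by rewrite mul0e lee_fin subr_ge0.
Qed.

End flow_theory.

Theorem theorem2 (R : realType) (n m : nat) (m_gt0 : (0 < m)%N)
    (F : 'rV[R]_n -> R) (l : 'I_m -> 'rV[R]_n -> R) (c e : R)
    (alpha : R -> R) (theta : R -> 'rV[R]_n)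
    (F_C1 : C1 F) (l_C1 : forall i, C1 (l i))
    (F_lb : has_lbound (range F)) (l_lb : forall i, has_lbound (range (l i)))
    (gradF_le : forall x, enorm (grad F x) <= c)
    (e_gt0 : 0 < e)
    (alpha_ge0 : forall t : R, 0 <= t -> 0 <= alpha t)
    (alpha_meas : measurable_fun (`[0, +oo[%classic : set (lebesgueTypeR R))
                    (alpha : lebesgueTypeR R -> R))
    (flow : pareto_flow F l e alpha theta)
    (theta0 : ~ pareto l e (theta 0)) :
  let te := first_time (pareto l e) theta in
  [/\ {ae lebesgue_measure, forall t : R, 0 <= t -> (t%:E < te)%E ->
        forall i, derivable (l i \o theta) t 1 /\
          derive1 (l i \o theta) t <= - (alpha t * gfun l (theta t))},
      forall t : R, 0 <= t -> (t%:E < te)%E ->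
        let A := (\int[completed_lebesgue_measure]_(s in `[0%R, t])
                    (alpha s)%:E)%E in
        (0 < A)%E ->
        exists2 gmin, minima [set gfun l (theta s) | s in `[0, t]] gmin &
          (gmin%:E <=
            (minimum (range (fun i => l i (theta 0) - inf (range (l i)))))%:E
              / A)%E,
      {ae lebesgue_measure, forall t : R, 0 <= t ->
        ~ pareto l e (theta t) -> 0 < alpha t * gfun l (theta t) ->
        forall i, derivable (l i \o theta) t 1 /\
          derive1 (l i \o theta) t < 0} &
      (\int[completed_lebesgue_measure]_(s in `[0%R, +oo[) (alpha s)%:E
         = +oo)%E ->
      forall eps : R, e < eps ->
        exists2 teps : R, 0 <= teps &
          pareto l eps (theta teps) /\
          forall t : R, teps <= t -> pareto_closure l eps (theta t)].
Proof.
move=> te.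
have before_te t s : 0 <= s <= t -> (t%:E < te)%E -> ~ pareto l e (theta s).
  move=> /andP[s0 st] tte Ps; move: tte; apply/negP; rewrite -leNgt.
  apply: (@le_trans _ _ s%:E); last by rewrite lee_fin.
  apply: ereal_inf_lbound; exists s; last exact: erefl.
  exact: (conj s0 Ps).
have ae_dl := flow_derive1_le l_C1 flow.
have decrease := flow_loss_decrease l_C1 alpha_ge0 alpha_meas flow.
have inf_le i x : inf (range (l i)) <= l i x by apply: ge_inf => //; exists x.
split.
- move: ae_dl; apply: filterS.
    exact: (ae_filter_ringOfSetsType (@lebesgue_measure R)).
  move=> t dl t0 tte; have tt : 0 <= t <= t by rewrite t0 lexx.
  exact: dl t0 (before_te t t tt tte).
- move=> t t0 tte A A0.
  have [s st smin] := flow_gfun_min m_gt0 l_C1 flow t0.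
  have gs0 : 0 < gfun l (theta s).
    have /negP := before_te t s st tte; rewrite -ltNge; exact: lt_trans.
  exists (gfun l (theta s)).
    split; first by exists s => //=; rewrite in_itv.
    by move=> _ [u /= ut <-]; apply: smin; move: ut; rewrite in_itv.
  have bound i : ((gfun l (theta s))%:E * A <=
      (l i (theta 0) - inf (range (l i)))%:E)%E.
    apply: le_trans (decrease i 0 t _ (lexx 0) t0 (ltW gs0) _) _.
      move=> u /andP[u0 ut]; have u0t : 0 <= u <= t by rewrite !ltW.
      by split; [exact: smin|exact: before_te u0t tte].
    by rewrite lee_fin lerB.
  have [i ->] := minimum_finite_range
    (fun i => l i (theta 0) - inf (range (l i))) m_gt0.
  (* Since [g] is positive at its minimum, an infinite [A] would contradict the finite bound; so [A]
     is a positive real and division is legitimate. *)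
  have := bound i; case: A A0 {bound} => [A|_|//].
    rewrite lte_fin => A0; rewrite -EFinM lee_fin => bi.
    by rewrite inver gt_eqF// -EFinM lee_fin ler_pdivlMr.
  by rewrite gt0_muley ?lte_fin// leye_eq.
- move: ae_dl; apply: filterS.
    exact: (ae_filter_ringOfSetsType (@lebesgue_measure R)).
  move=> t dl t0 Pt ag0 i; have [dli dle] := dl t0 Pt i.
  by split => //; apply: le_lt_trans dle _; rewrite oppr_lt0.
- move=> alphaoo eps e_eps; have eps0 := lt_trans e_gt0 e_eps.
  suff [s s0 Ps] : exists2 s, 0 <= s & pareto l eps (theta s).
    exists s => //; split; first exact: Ps.
    move=> t st.
    exact: (flow_pareto_closure m_gt0 l_C1 e_gt0 alpha_ge0 alpha_meas flow
      e_eps s0 st Ps).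
  apply: contrapT => never.
  have far s : 0 <= s -> eps < gfun l (theta s).
    by move=> s0; rewrite ltNge; apply/negP => Ps; apply: never; exists s.
  (* A single loss suffices for the contradiction: it would have to fall below its infimum. *)
  pose i := Ordinal m_gt0.
  have bound t : 0 <= t ->
      (eps%:E * \int[completed_lebesgue_measure]_(s in `[0%R, t]) (alpha s)%:E
        <= (l i (theta 0) - inf (range (l i)))%:E)%E.
    move=> t0.
    apply: le_trans (decrease i 0 t _ (lexx 0) t0 (ltW eps0) _) _.
      move=> u /andP[/ltW u0 _]; have epsu := far u u0.
      split; first exact: ltW.
      by move=> /(lt_le_trans (lt_trans e_eps epsu)); rewrite ltxx.
    by rewrite lee_fin lerB.
  (* The threshold is the largest value of the integral of [alpha] that [bound] permits. *)
  have [t t0] := ge0_integral_ray_pinfty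
    ((l i (theta 0) - inf (range (l i))) / eps) alpha_meas alpha_ge0 alphaoo.
  apply/negP; rewrite -leNgt; move: (bound t t0).
  case: (integral _ _ _) => [A|/=|_]; last exact: leNye.
    by rewrite -EFinM !lee_fin ler_pdivlMr// mulrC.
  by rewrite gt0_muley ?lte_fin// leye_eq.
Qed.
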